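(* Let $m$ be a positive integer and let $f:\mathbb{Z}_{\geq 0}\to\mathbb{Z}_{\geq 0}$ be an increasing function such that $f(i+1)\geq 2f(i)$ for all $i>0$. If $d\in\mathbb{Z}_{\geq 0}$ is such that $$2f(i+1)\leq A(d,f(i)-1)\quad\text{for all } i>0,$$ then $$\mathfrak{L}_{f,m}^{1}< \big\lceil f^{-1}(A(m+d,2f(1)-1))\big\rceil.$$ Moreover, if $d\geq 3$, then, for every integer $n>1$, $$\mathfrak{L}_{f,m}^{n}< \big\lceil f^{-1}(A(m+d+2,\,2f(1)n-1)/n)\big\rceil.$$
   Context: The Ackermann function $A:\mathbb{Z}_{\geq 0}\times\mathbb{Z}_{\geq 0}\to\mathbb{Z}_{\geq 0}$ is defined by $A(0,n)=n+1$, $A(m+1,0)=A(m,1)$, $A(m+1,n+1)=A(m,A(m+1,n))$ for $m,n\geq 0$. The expressions $A(\cdot,\cdot)$ in the statement are understood to be defined, i.e. their arguments are nonnegative integers (in particular $f(i)-1\ge 0$ for $i>0$). ''Increasing'' means $f(i)\leq f(j)$ whenever $i\leq j$. For real $x$, $\lceil f^{-1}(x)\rceil$ denotes the least nonnegative integer $k$ such that $f(k)\geq x$. For a positive integer $n$, write $n=\{0,1,\dots,n-1\}$ and order $\mathbb{Z}_{\geq 0}^m\times n$ by: $(\tau,i)\leq(\eta,j)$ iff $i=j$ and $\tau\leq\eta$ in the product (coordinatewise) order. The degree of $a=(\tau,i)$ with $\tau=(\tau_1,\dots,\tau_m)$ is $\deg a=\tau_1+\cdots+\tau_m$. An antichain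 sequence of $\mathbb{Z}_{\geq 0}^m\times n$ is a finite sequence $a_1,\dots,a_k$ such that $a_i\nleq a_j$ for all $i\neq j$; its degree growth is bounded by $f$ if $\deg a_i\leq f(i)$ for all $i$. $\mathfrak{L}_{f,m}^n$ denotes the maximal length of an antichain sequence of $\mathbb{Z}_{\geq 0}^m\times n$ with degree growth bounded by $f$. *)

(* Defs.v *)
From mathcomp Require Import all_boot all_order all_algebra.
Import Order.TTheory GRing.Theory Num.Theory.
Set Implicit Arguments.
Unset Strict Implicit.
Unset Printing Implicit Defensive.

Fixpoint ackermann (m : nat) : nat -> nat :=
  if m is m'.+1 then
    fix ackermann_m n :=
      if n is n'.+1 then ackermann m' (ackermann_m n') else ackermann m' 1
  else S.

Lemma ackermann0n n : ackermann 0 n = n.+1. Proof. by []. Qed.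

Lemma ackermannS0 m : ackermann m.+1 0 = ackermann m 1. Proof. by []. Qed.

Lemma ackermannSS m n :
  ackermann m.+1 n.+1 = ackermann m (ackermann m.+1 n).
Proof. by []. Qed.

Definition point (m n : nat) : Type := ({ffun 'I_m -> nat} * 'I_n)%type.

Definition point_le m n (a b : point m n) : bool :=
  (a.2 == b.2) && [forall l, a.1 l <= b.1 l].

Definition deg m n (a : point m n) : nat := \sum_(l < m) a.1 l.

Definition antichain_seq m n k (a : 'I_k -> point m n) : Prop :=
  forall i j : 'I_k, i != j -> ~~ point_le (a i) (a j).

(* Sequences are a_1, ..., a_k in the mathematics: the entry with ordinal i is
   a_(i+1), so its degree is bounded by f (i+1). *)
Definition degree_growth_bounded (f : nat -> nat) m n k
    (a : 'I_k -> point m n) : Prop :=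
  forall i : 'I_k, deg (a i) <= f i.+1.

Definition has_antichain_seq (f : nat -> nat) (m n k : nat) : Prop :=
  exists a : 'I_k -> point m n, antichain_seq a /\ degree_growth_bounded f a.

Definition is_max_antichain_length (f : nat -> nat) (m n L : nat) : Prop :=
  has_antichain_seq f m n L /\
  forall k, has_antichain_seq f m n k -> k <= L.

(* The ceiling of f^-1(x) is k; f need not be invertible. *)
Definition is_ceil_inv (R : realFieldType) (f : nat -> nat) (x : R)
    (k : nat) : Prop :=
  (x <= (f k)%:R)%R /\ forall j, (x <= (f j)%:R)%R -> k <= j.

(* Main.v *)
Require Import Defs.
From mathcomp Require Import all_boot all_order all_algebra.
From mathcomp Require Import zify.
From Stdlib Require Import Classical.
Import Order.TTheory GRing.Theory Num.Theory.
Set Implicit Arguments.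
Unset Strict Implicit.
Unset Printing Implicit Defensive.

(** The bound comes from following how an antichain breaks its ambient set
    into pieces of smaller and smaller dimension.  If p has been played, no
    later x satisfies p <= x, so x has some coordinate l with
    x_l < p_l: what is left of a copy of N^m lies in the slices x_l = v with
    v < p_l.  These are deg p copies of N^(m-1) ([slices_cover]), hence at most
    f(i) of them if p is played at time i.  A slice is encoded here as a
    [block]: a base point together with the set of coordinates left free.

    The heart is [bound_blocks]: if the terms played at the times in (i, T]
    lie in N blocks of dimension at most m, then
    f(T) < A(d + m + 1, f(i) + N - 1).  It is proved by induction on m.

    In dimension 0 a block is exhausted by a single term.  The hypothesis
    2 f(i+1) <= A(d, f(i) - 1) says that f grows by at most one application
    of A(d, _) per time step, so N steps are N applications of A(d, _), which
    add N to the second argument of A(d + 1, _).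

    In dimension m + 1, consider the times i_1 < i_2 < ... at which a block
    receives its first term and is thereby split.  Between two of them only
    the slices of the split blocks are available.  Since f at least doubles,
    their number is at most f(i_1) + ... + f(i_r) < 2 f(i_r), whichever order
    the blocks are visited in, so the case of dimension m, applied afresh from
    time i_r, bounds f just before i_(r+1) by A(d + m + 1, 3 f(i_r) - 2).  Each
    split therefore costs about one application of A(d + m + 1, _), and N of
    them add N to the second argument of A(d + m + 2, _)
    ([bound_partly_split]).  The constants are absorbed because d >= 3 is
    forced by the hypotheses on f ([ack_level_gt2]), and from level 3 on,
    increasing the second argument of A by 1 at least doubles its value.

    For one copy of N^m, the first term splits it into at most f(1) blocks of
    dimension m - 1, and [bound_blocks] from time 1 gives exactly
    f(k) < A(m + d, 2 f(1) - 1).  For n copies the sequence is delayed by one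
    time unit, which keeps its degrees bounded as f increases;
    [bound_blocks] from time 1 with n blocks then bounds f(k) by
    A(m + d + 1, f(1) + n), and the factor n is absorbed by the additional
    level of A.  Since f is unbounded these inequalities bound the lengths of
    antichain sequences, so the maximal length exists, and f(L) < x is
    equivalent to L being smaller than the least K with x <= f(K). *)

(** * The Ackermann function *)

Lemma ltn_ack m n : n < ackermann m n.
Proof.
elim: m n => [|m IHm] // n; elim: n => [|n IHn].
  by rewrite ackermannS0; apply: leq_ltn_trans (IHm 1).
by rewrite ackermannSS; apply: leq_ltn_trans (IHm _).
Qed.

Lemma ack_ltS m n : ackermann m n < ackermann m n.+1.
Proof. by case: m => [|m] //; rewrite ackermannSS; apply: ltn_ack. Qed.

Lemma leq_ack2l m n p : n <= p -> ackermann m n <= ackermann m p.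
Proof.
move=> /subnK <-; elim: (p - n) => // q IHq.
by apply: leq_trans IHq _; rewrite addSn ltnW ?ack_ltS.
Qed.

Lemma ack_shift m n : ackermann m n.+1 <= ackermann m.+1 n.
Proof.
elim: n => // n IHn; rewrite ackermannSS; apply: leq_ack2l.
by apply: leq_trans IHn; apply: ltn_ack.
Qed.

Lemma leq_ack2r m p n : m <= p -> ackermann m n <= ackermann p n.
Proof.
move=> /subnK <-; elim: (p - m) => // q IHq; rewrite addSn.
by apply: leq_trans IHq _; apply: leq_trans (ack_shift _ _); apply/ltnW/ack_ltS.
Qed.

Lemma ack1 n : ackermann 1 n = n + 2.
Proof. by elim: n => [|n IHn] //; rewrite ackermannSS IHn ackermann0n. Qed.

Lemma ack2 n : ackermann 2 n = 2 * n + 3.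
Proof. elim: n => [|n IHn] //; rewrite ackermannSS IHn ack1; lia. Qed.

(** The value 2z + 3 of A(2, z) is already more than twice z, and one step in
    the second argument applies a function at least as large as A(2, _). *)
Lemma ack_double m n : 2 < m -> 2 * ackermann m n <= ackermann m n.+1.
Proof.
case: m => // m m_gt1; rewrite ackermannSS.
have := leq_ack2r (ackermann m.+1 n) (m_gt1 : 2 <= m); rewrite ack2; lia.
Qed.

Lemma ack_mul_exp m n p :
  2 < m -> 2 ^ p * ackermann m n <= ackermann m (n + p).
Proof.
move=> m_gt2; elim: p => [|p IHp]; first by rewrite mul1n addn0.
rewrite addnS expnS -mulnA; apply: leq_trans (ack_double _ m_gt2).
by rewrite leq_mul2l IHp.
Qed.

(** * Blocks and their slices *)

(** A base point and a set of free coordinates: the affine piece of points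
    agreeing with the base point off that set, of dimension its cardinal.
    Slices stay in the same ambient space, so the induction on the dimension
    never changes the type of the points or their degrees. *)
Definition block (M n : nat) : Type := (point M n * {set 'I_M})%type.

Definition in_block M n (x : point M n) (b : block M n) : bool :=
  (x.2 == b.1.2) && [forall l, (l \notin b.2) ==> (x.1 l == b.1.1 l)].

Definition slices M n (b : block M n) (p : point M n) : seq (block M n) :=
  [seq (([ffun k => if k == l then v else p.1 k], p.2), b.2 :\ l)
    | l <- enum b.2, v <- iota 0 (p.1 l)].

Lemma size_slices M n (b : block M n) (p : point M n) :
  size (slices b p) = \sum_(l in b.2) p.1 l.
Proof.
rewrite size_allpairs_dep sumnE big_map -big_enum.
by apply: eq_bigr => l _; rewrite size_iota.
Qed.

Lemma size_slices_deg M n (b : block M n) (p : point M n) :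
  size (slices b p) <= deg p.
Proof.
by rewrite size_slices /deg [leqRHS](bigID (mem b.2)) /= leq_addr.
Qed.

Lemma dim_slices M n (b : block M n) (p : point M n) m :
  #|b.2| <= m.+1 -> all (fun c : block M n => #|c.2| <= m) (slices b p).
Proof.
move=> dim_b; apply/allP => _ /allpairsPdep [l [v [lb _ ->]]] /=.
by rewrite mem_enum in lb; move: dim_b; rewrite (cardsD1 l) lb.
Qed.

(** Off the free coordinates p and x agree, so the coordinate witnessing that
    p <= x fails is free and takes at x a value below that of p. *)
Lemma slices_cover M n (b : block M n) (p x : point M n) :
  in_block p b -> in_block x b -> ~~ point_le p x ->
  has (in_block x) (slices b p).
Proof.
move=> /andP[/eqP p2 /forall_inP p1] /andP[/eqP x2 /forall_inP x1].
rewrite /point_le p2 x2 eqxx /= => /forallPn[l]; rewrite -ltnNge => xl.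
have lb : l \in b.2.
  apply: contraLR xl => lNb.
  by rewrite (eqP (p1 l lNb)) (eqP (x1 l lNb)) ltnn.
apply/hasP; exists (([ffun k => if k == l then x.1 l else p.1 k], p.2), b.2 :\ l).
  by apply/allpairsPdep; exists l, (x.1 l); rewrite mem_enum mem_iota.
rewrite /in_block /= p2 x2 eqxx; apply/forall_inP => k /=.
rewrite !inE ffunE negb_and negbK; case: eqP => [-> //|_ /= kNb].
by rewrite (eqP (p1 k kNb)) x1.
Qed.

(** * Sequences in a time window *)

(** Splitting uses that an earlier term does not lie below a later one, the
    condition of a bad sequence.  The window (i, T] is explicit because the induction on the dimension
    restarts at every time at which a block is split. *)
Definition controlled_bad (f : nat -> nat) M n (a : nat -> point M n)
    (i T : nat) : Prop :=
  forall t, i < t <= T ->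
    deg (a t) <= f t /\ forall s, i < s < t -> ~~ point_le (a s) (a t).

Definition covered M n (a : nat -> point M n) (i T : nat)
    (bs : seq (block M n)) : Prop :=
  forall t, i < t <= T -> has (in_block (a t)) bs.

Lemma controlled_bad_sub f M n (a : nat -> point M n) i T i' T' :
  i <= i' -> T' <= T -> controlled_bad f a i T -> controlled_bad f a i' T'.
Proof.
move=> ii' TT' bad t it.
have [|? bad_t] := bad t; first lia.
by split=> // s Hs; apply: bad_t; lia.
Qed.

Lemma covered_sub M n (a : nat -> point M n) i T i' T' bs :
  i <= i' -> T' <= T -> covered a i T bs -> covered a i' T' bs.
Proof. by move=> ii' TT' cov t it; apply: cov; lia. Qed.

(** Once one of its points has been played, a block can be traded for its
    slices.  The list [os] of the blocks that are already split is kept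
    apart because its members have smaller dimension. *)
Lemma covered_split f M n (a : nat -> point M n) i j T os bs b :
  controlled_bad f a i T -> i < j -> covered a j T (os ++ bs) ->
  b \in bs -> in_block (a j) b ->
  covered a j T ((os ++ slices b (a j)) ++ rem b bs).
Proof.
move=> bad ij cov bbs ajb t jt; rewrite !has_cat -orbA.
have := cov t jt; rewrite has_cat (perm_has _ (perm_to_rem bbs)) /=.
case: has => //= /orP[atb|->]; last by rewrite orbT.
rewrite slices_cover //; have [|_ ->//] := bad t; lia.
Qed.

(** * Growth of the bounding function along a covered sequence *)

Section Growth.

Variables (f : nat -> nat) (d : nat).
Hypothesis f_incr : forall i j : nat, i <= j -> f i <= f j.
Hypothesis f_double : forall i : nat, 0 < i -> 2 * f i <= f i.+1.
Hypothesis f_gt0 : forall i : nat, 0 < i -> 0 < f i.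
Hypothesis f_ack : forall i : nat, 0 < i -> 2 * f i.+1 <= ackermann d (f i - 1).

(** A(2, z) = 2z + 3, so for d <= 2 the hypothesis at 1 would give
    2 f(2) <= 2 f(1) + 1, against f(2) >= 2 f(1) > 0. *)
Lemma ack_level_gt2 : 2 < d.
Proof.
rewrite ltnNge; apply/negP => d_le2.
have := leq_ack2r (f 1 - 1) d_le2; rewrite ack2.
have := @f_ack 1 isT; have := @f_double 1 isT; have := @f_gt0 1 isT; lia.
Qed.

Lemma leq_f_id i : i <= f i.
Proof.
elim: i => // -[|i] IHi; first exact: f_gt0.
have := @f_double i.+1 isT; lia.
Qed.

Lemma f_lt_ack e i : 0 < i -> 0 < e -> f i < ackermann e (f i - 1).
Proof.
move=> i_gt0 e_gt0; have := leq_ack2r (f i - 1) e_gt0.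
rewrite ack1; have := f_gt0 i_gt0; lia.
Qed.

(** One time step costs one application of A(d, _), hence at most one unit in
    the second argument at any level above d. *)
Lemma f_step i e y :
  0 < i -> d <= e -> f i <= (ackermann e.+1 y).+1 ->
  2 * f i.+1 <= ackermann e.+1 y.+1.
Proof.
move=> i_gt0 de fi; apply: leq_trans (f_ack i_gt0) _.
rewrite ackermannSS; apply: leq_trans (leq_ack2r _ de) _.
by apply: leq_ack2l; lia.
Qed.

Section Dimension.

Variables (M n : nat) (a : nat -> point M n).

(** A block without free coordinate has no slices, so every term removes a
    block from the cover and every time step uses up one. *)
Lemma bound_points i T (bs : seq (block M n)) z :
  0 < i <= T -> controlled_bad f a i T -> covered a i T bs ->
  all (fun b : block M n => #|b.2| <= 0) bs ->
  f i < ackermann d.+1 z -> f T < ackermann d.+1 (z + size bs).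
Proof.
move sz: (size bs) => k; elim: k bs sz i z => [|k IHk] bs sz i z;
  move=> /andP[i_gt0 iT] bad cov dim0 fi.
  have -> : T = i; last by rewrite addn0.
  move/size0nil: sz cov => ->; case: ltngtP iT => // iT _ /(_ i.+1).
  by rewrite ltnSn iT => /(_ isT).
have [<-|iNT] := eqVneq i T.
  by apply: leq_trans fi _; apply: leq_ack2l; rewrite leq_addr.
have /hasP[b bbs ab] := cov i.+1 ltac:(lia).
have dim_b := allP dim0 _ bbs.
have no_slices : slices b (a i.+1) = [::].
  apply: size0nil; rewrite size_slices big1 // => l lb.
  by move: dim_b; rewrite (cardsD1 l) lb.
have szr : size (rem b bs) = k by rewrite size_rem // sz.
rewrite addnS -addSn; apply: (IHk _ szr i.+1) => //.
- lia.
- exact: controlled_bad_sub bad.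
- have := @covered_split f M n a i i.+1 T [::] bs b bad (ltnSn i).
  by rewrite no_slices; apply=> //; apply: covered_sub cov.
- by apply/allP => c /mem_rem; apply: (allP dim0).
- have := @f_step i d z i_gt0 (leqnn d); have := @f_gt0 i.+1 isT; lia.
Qed.

Section Step.

Variable m : nat.
Let e := d + m.+1.
Hypothesis bound_m : forall i T (bs : seq (block M n)),
  0 < i <= T -> controlled_bad f a i T -> covered a i T bs ->
  all (fun b : block M n => #|b.2| <= m) bs ->
  f T < ackermann e (f i + size bs - 1).

(** The induction over the splittings.  The blocks [os] of dimension m come
    from earlier splittings and [bs] are still intact.  The invariant
    size os < 2 f(i) survives a splitting at time j because
    2 f(i) + f(j) <= 2 f(j).  The factor 4 is what makes the other invariant
    reproduce itself: A(e, _) is applied to f(i) + size os < 3 f(i), and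
    the doubling lost in 4 f(j) against 2 f(j) costs one more unit in the
    second argument of A(e, _), which 4 f(i) pays for. *)
Lemma bound_partly_split i T (os bs : seq (block M n)) y :
  0 < i <= T -> controlled_bad f a i T -> covered a i T (os ++ bs) ->
  all (fun b : block M n => #|b.2| <= m) os ->
  all (fun b : block M n => #|b.2| <= m.+1) bs ->
  size os < 2 * f i -> 4 * f i <= ackermann e.+1 y ->
  f T < ackermann e.+1 (y + size bs).+1.
Proof.
move sz: (size bs) => k; elim: k bs sz i os y => [|k IHk] bs sz i os y;
  move=> /andP[i_gt0 iT] bad cov dim_o dim_b sz_o fi.
  move/size0nil: sz cov => ->; rewrite cats0 addn0 ackermannSS => cov.
  apply: leq_trans (bound_m _ bad cov dim_o) _; first by rewrite i_gt0.
  by apply: leq_ack2l; lia.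
(* The next splitting happens at the first time the sequence escapes [os]. *)
pose esc t := (i < t <= T) && ~~ has (in_block (a t)) os.
have [/existsP[t0 esc0]|none] := boolP [exists t : 'I_T.+1, esc t]; last first.
  have cov_o : covered a i T os.
    move=> t it; apply: contraNT none => Nt; apply/existsP.
    have tT : t < T.+1 by lia.
    by exists (Ordinal tT); rewrite /esc it.
  apply: leq_trans (bound_m _ bad cov_o dim_o) _; first by rewrite i_gt0.
  rewrite ackermannSS; apply: leq_ack2l.
  have := @leq_ack2l e.+1 _ _ (leq_addr k.+1 y); lia.
have ex_esc : exists t, esc t by exists t0.
case: (ex_minnP ex_esc) => -[|j] /andP[/andP[ij jT] Nj] minj //.
rewrite ltnS in ij.
have cov_o : covered a i j os.
  move=> t it; have [//|Nt] := boolP (has (in_block (a t)) os).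
  have /minj : esc t by rewrite /esc Nt; lia.
  lia.
have fj : f j < ackermann e (f i + size os - 1).
  apply: bound_m => //; first by rewrite i_gt0.
  by apply: controlled_bad_sub bad => //; lia.
have /hasP[b bbs ab] : has (in_block (a j.+1)) bs.
  by have := cov j.+1; rewrite has_cat (negPf Nj); apply; lia.
have szr : size (rem b bs) = k by rewrite size_rem // sz.
have j_gt0 : 0 < j by lia.
have fij : 2 * f i <= f j.+1.
  by have := f_double j_gt0; have := f_incr ij; lia.
have [|deg_j _] := bad j.+1; first lia.
have sz_s := size_slices_deg b (a j.+1).
rewrite addnS -addSn; apply: (IHk _ szr j.+1 (os ++ slices b (a j.+1))) => //.
- by apply: controlled_bad_sub bad => //; lia.
- apply: (covered_split bad) bbs ab; first lia.
  by apply: covered_sub cov => //; lia.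
- by rewrite all_cat dim_o dim_slices // (allP dim_b).
- by apply/allP => c /mem_rem; apply: (allP dim_b).
- by rewrite size_cat; lia.
(* Up to time j only [os] is used, so [bound_m] controls f(j); the step to
   j + 1 then fits into one more unit of the second argument. *)
- have e_gt2 : 2 < e by have := ack_level_gt2; rewrite /e; lia.
  have step : 2 * f j.+1 <= ackermann e (f i + size os).
    have -> : f i + size os = (f i + size os - 1).+1 by have := f_gt0 i_gt0; lia.
    have -> : e = (d + m).+1 by rewrite /e addnS.
    apply: f_step => //; first exact: leq_addr.
    by rewrite -addnS; apply/leqW/ltnW.
  rewrite ackermannSS.
  have := @leq_ack2l e (f i + size os).+1 _ _; move=> /(_ (ackermann e.+1 y)).
  have := ack_double (f i + size os) e_gt2; lia.
Qed.

End Step.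

(** In positive dimension the first term splits a block before
    [bound_partly_split] takes over at time i + 1 with y = f(i) - 1 and one
    intact block less.  Starting it at time i with all the blocks intact and
    the same y would give a bound too large by one unit of the second
    argument, and the sharp constant is what the case of one copy requires. *)
Theorem bound_blocks m i T (bs : seq (block M n)) :
  0 < i <= T -> controlled_bad f a i T -> covered a i T bs ->
  all (fun b : block M n => #|b.2| <= m) bs ->
  f T < ackermann (d + m.+1) (f i + size bs - 1).
Proof.
elim: m i T bs => [|m IHm] i T bs iT bad cov dim_b;
  have [i_gt0 leiT] := andP iT; have fi_gt0 := f_gt0 i_gt0.
  rewrite addn1 -addnBAC //; apply: bound_points iT bad cov dim_b _.
  exact: f_lt_ack.
rewrite -addnBAC //.
have [<-|iNT] := eqVneq i T.
  apply: leq_trans (f_lt_ack i_gt0 (isT : 0 < 1)) _.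
  apply: leq_trans (leq_ack2l _ (leq_addr _ _)) (leq_ack2r _ _); lia.
have [|deg_i _] := bad i.+1; first lia.
have /hasP[b bbs ab] := cov i.+1 ltac:(lia).
have sz_s := size_slices_deg b (a i.+1).
have fS_gt0 := @f_gt0 i.+1 isT.
have -> : size bs = (size (rem b bs)).+1.
  by rewrite size_rem // prednK //; case: (bs) bbs.
rewrite [d + _]addnS [_ + (size _).+1]addnS.
apply: (bound_partly_split IHm (i := i.+1) (os := slices b (a i.+1))) => //.
- lia.
- exact: controlled_bad_sub bad.
- apply: (@covered_split f M n a i i.+1 T [::] bs b) => //.
  exact: covered_sub cov.
- exact: dim_slices (allP dim_b _ bbs).
- by apply/allP => c /mem_rem; apply: (allP dim_b).
- lia.
- have := f_ack i_gt0; have := ack_double (f i - 1) ack_level_gt2.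
  have := ack_shift d (f i - 1).
  have := @leq_ack2r d.+1 (d + m.+1).+1 (f i - 1) ltac:(lia); lia.
Qed.

End Dimension.

(** * Antichain sequences *)

Lemma antichain_bound_single m k :
  has_antichain_seq f m.+1 1 k -> f k < ackermann (m.+1 + d) (2 * f 1 - 1).
Proof.
case: k => [_|k [a0 [anti grow]]].
  apply: leq_ltn_trans (f_incr (leq0n 1)) _.
  apply: leq_trans (f_lt_ack (isT : 0 < 1) (isT : 0 < 1)) _.
  by apply: leq_trans (leq_ack2r _ _) (leq_ack2l _ _); lia.
(* Terms are numbered from 1, ordinals from 0. *)
pose a t := a0 (inord t.-1).
have bad : controlled_bad f a 0 k.+1.
  move=> t /andP[t_gt0 tk]; split.
    by apply: leq_trans (grow _) _; rewrite inordK prednK.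
  move=> s st; apply: anti; rewrite -val_eqE /= !inordK; lia.
pose b : block m.+1 1 := (a 1, setT).
have in_b x : in_block x b.
  by rewrite /in_block (ord1 x.2) (ord1 b.1.2) eqxx; apply/forall_inP => l; rewrite inE.
have cov : covered a 1 k.+1 (slices b (a 1)).
  have := @covered_split f _ _ a 0 1 k.+1 [::] [:: b] b bad isT.
  rewrite /= eqxx cats0; apply; rewrite ?mem_seq1 ?eqxx //.
  by move=> t _ /=; rewrite in_b.
have [|deg1 _] := bad 1 => //.
have sz_s := size_slices_deg b (a 1).
have := @bound_blocks _ _ a m 1 k.+1 _ isT
  (controlled_bad_sub (leq0n 1) (leqnn _) bad) cov.
rewrite dim_slices ?cardsT ?card_ord // => /(_ isT) lt_f.
apply: leq_trans lt_f _; rewrite addSnnS addnC addSnnS.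
by apply: leq_ack2l; lia.
Qed.

(** The n copies of N^m are n blocks, but the sequence starts at time 1, and
    [bound_blocks] needs a positive time before the window.  Delaying the
    sequence by one unit provides it.  The factor n is at most 2^n, which
    [ack_mul_exp] turns into n more units of the second argument. *)
Lemma antichain_bound m n k : 0 < n ->
  has_antichain_seq f m n k ->
  n * f k < ackermann (m + d + 2) (2 * f 1 * n - 1).
Proof.
move=> n_gt0 [a0 [anti grow]]; have f1_gt0 := @f_gt0 1 isT.
have fk : f k <= ackermann (d + m.+1) (f 1 + n).
  case: k a0 anti grow => [|k] a0 anti grow.
    apply: leq_trans (f_incr (leq0n 1)) _.
    by apply: leq_trans (leq_addr n _) (ltnW (ltn_ack _ _)).
  (* The term numbered t - 1 is played at time t. *)
  pose a t := a0 (inord t.-2).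
  have bad : controlled_bad f a 1 k.+2.
    move=> t /andP[t_gt1 tk]; split.
      apply: leq_trans (grow _) _; rewrite inordK; last lia.
      by apply: f_incr; lia.
    move=> s st; apply: anti; rewrite -val_eqE /= !inordK; lia.
  pose bs : seq (block m n) := [seq (([ffun=> 0], c), setT) | c <- enum 'I_n].
  have cov : covered a 1 k.+2 bs.
    move=> t _; apply/hasP; exists (([ffun=> 0], (a t).2), setT).
      by apply/mapP; exists (a t).2; rewrite ?mem_enum.
    by rewrite /in_block eqxx; apply/forall_inP => l; rewrite inE.
  have dim_bs : all (fun b : block m n => #|b.2| <= m) bs.
    by apply/allP => _ /mapP[c _ ->]; rewrite cardsT card_ord.
  have := bound_blocks (isT : 0 < 1 <= k.+2) bad cov dim_bs.
  rewrite size_map size_enum_ord => lt_f.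
  apply: leq_trans (f_incr (leqnSn _)) _; apply: leq_trans (ltnW lt_f) _.
  by apply: leq_ack2l; lia.
have E_gt2 : 2 < d + m.+1 by have := ack_level_gt2; lia.
have := ack_mul_exp (f 1 + n) n E_gt2.
have n_lt := ltn_expl n (isT : 1 < 2).
have lt_n : n * f k < 2 ^ n * ackermann (d + m.+1) (f 1 + n).
  apply: leq_ltn_trans (leq_mul (leqnn n) fk) _.
  by rewrite ltn_pmul2r //; apply: leq_ltn_trans (ltn_ack _ _).
move=> le_ack; apply: leq_trans lt_n _; apply: leq_trans le_ack _.
have -> : m + d + 2 = (d + m.+1).+1 by lia.
have -> : 2 * f 1 * n - 1 = (2 * f 1 * n - 2).+1 by nia.
rewrite ackermannSS; apply: leq_ack2l.
have := @leq_ack2r 2 (d + m.+1).+1 (2 * f 1 * n - 2) ltac:(lia).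
rewrite ack2; nia.
Qed.

End Growth.

Lemma ex_max_classical (P : nat -> Prop) B :
  P 0 -> (forall k, P k -> k <= B) ->
  exists L, P L /\ forall k, P k -> k <= L.
Proof.
move=> P0; elim: B => [|B IHB] bnd; first by exists 0.
have [PB|NPB] := classic (P B.+1); first by exists B.+1.
apply: IHB => k Pk; have := bnd k Pk; rewrite leq_eqVlt => /orP[/eqP kB|//].
by case: NPB; rewrite -kB.
Qed.

Lemma max_lt_ceil_inv (R : realFieldType) (f : nat -> nat) m n c B :
  (forall i j, i <= j -> f i <= f j) -> (forall i, i <= f i) ->
  0 < n -> 0 < c ->
  (forall k, has_antichain_seq f m n k -> c * f k < B) ->
  exists L K : nat,
    [/\ is_max_antichain_length f m n L,
        is_ceil_inv f (B%:R / c%:R : R)%R K & L < K].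
Proof.
move=> f_incr f_id n_gt0 c_gt0 bnd.
have leE j : (B%:R / c%:R <= (f j)%:R :> R)%R = (B <= c * f j).
  by rewrite ler_pdivrMr ?ltr0n // -natrM ler_nat mulnC.
have anti0 : has_antichain_seq f m n 0.
  by exists (fun=> ([ffun=> 0], Ordinal n_gt0)); split=> -[].
have [|L [antiL maxL]] := @ex_max_classical _ B anti0.
  move=> k /bnd; have := f_id k; nia.
have exK : exists K, B <= c * f K by exists B; have := f_id B; nia.
case: (ex_minnP exK) => K leK minK; exists L, K; split=> //.
  by split=> [|j]; rewrite leE //; apply: minK.
rewrite ltnNge; apply/negP => /f_incr fKL.
by have := bnd L antiL; rewrite ltnNge (leq_trans leK) // leq_mul2l fKL orbT.
Qed.

Theorem proposition3p1 (R : realFieldType) (m : nat) (f : nat -> nat) (d : nat)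
    (m_gt0 : 0 < m)
    (f_incr : forall i j : nat, i <= j -> f i <= f j)
    (f_double : forall i : nat, 0 < i -> 2 * f i <= f i.+1)
    (f_gt0 : forall i : nat, 0 < i -> 0 < f i)
    (f_ack : forall i : nat, 0 < i -> 2 * f i.+1 <= ackermann d (f i - 1)) :
  (exists L K : nat,
     [/\ is_max_antichain_length f m 1 L,
         is_ceil_inv f ((ackermann (m + d) (2 * f 1%N - 1))%:R : R)%R K
       & L < K])
  /\
  (3 <= d -> forall n : nat, 1 < n ->
   exists L K : nat,
     [/\ is_max_antichain_length f m n L,
         is_ceil_inv f
           ((ackermann (m + d + 2) (2 * f 1%N * n - 1))%:R / n%:R : R)%R K
       & L < K]).
Proof.
split=> [|_ n n_gt1].
  case: m m_gt0 => // m _.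
  have := @max_lt_ceil_inv R f m.+1 1 1 (ackermann (m.+1 + d) (2 * f 1 - 1)).
  rewrite divr1; apply=> // [|k anti_k]; first exact: leq_f_id.
  by rewrite mul1n; apply: antichain_bound_single.
apply: max_lt_ceil_inv => // [|||k]; [exact: leq_f_id|lia|lia|].
by apply: antichain_bound => //; lia.
Qed.
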